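(* If $\phi=(\phi_{t,s})_{0\le s\le t\le T}$ is a stable almost flow and $\epsilon=(\epsilon_{t,s})_{0\le s\le t\le T}$ is a Lipschitz perturbation, then $\psi$ defined by $\psi_{t,s}:=\phi_{t,s}\circ(\mathrm{id}+\epsilon_{t,s})$, $0\le s\le t\le T$, is also a stable almost flow.
   Context: Setting. $(V,|\cdot|)$ is a Banach space and $T>0$ a time horizon. For $f:V\to V$, $\|f\|_\infty=\sup_a|f(a)|$ and $\|f\|_{\mathrm{Lip}}=\sup_{a\ne b}|f(a)-f(b)|/|a-b|$. A control $\omega$ is a family of numbers $\omega_{s,t}\ge0$, $0\le s\le t\le T$, which is super-additive ($\omega_{r,s}+\omega_{s,t}\le\omega_{r,t}$ for $r\le s\le t$), continuous near the diagonal, with $\omega_{s,s}=0$. A remainder $\varpi:[0,\omega_{0,T}]\to\mathbb R_+$ is a continuous increasing function such that for some $0<\varkappa<1$, $2\varpi(\tau/2)\le\varkappa\varpi(\tau)$ for $\tau>0$. $\delta:\mathbb R_+\to\mathbb R_+$, $T'\mapsto\delta_{T'}$, denotes a non-decreasing function with $\lim_{T'\to0}\delta_{T'}=0$; it may differ from one almost flow to another. 4-points control. A function $f:V\to V$ satisfies a 4-points control if there are a non-decreasing continuous function $\widehat f:\mathbb R_+\to\mathbb R_+$ and a constant $f^\dagger\ge0$ such that for all $a,b,c,d\in V$, $$|f(a)-f(b)-f(c)+f(d)|\le\widehat f(|a-b|\vee|c-d|)\,(|a-c|\vee|b-d|)+f^\dagger|a-b-c+d|.$$ Stable almost flow. A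 family of continuous maps $\phi_{t,s}:V\to V$, $0\le s\le t\le T$, is a stable almost flow if, with $\phi_{t,s,r}:=\phi_{t,s}\circ\phi_{s,r}-\phi_{t,r}$, there are such a $\delta$ and constants $M,C\ge0$ such that for every $T'\in(0,T]$ and all $0\le r\le s\le t\le T'$: (a) $\phi_{t,t}=\mathrm{id}$; $\|\phi_{t,s}-\mathrm{id}\|_\infty\le\delta_{T'}$; $\|\phi_{t,s}\|_{\mathrm{Lip}}\le1+\delta_{T'}$; $\|\phi_{t,s,r}\|_\infty\le M\varpi(\omega_{r,t})$; (b) each $\phi_{t,s}$ satisfies a 4-points control with some $\widehat\phi_{t,s}$ and $\phi^\dagger_{t,s}\le1+\delta_{T'}$, and it is $\varpi$-compatible: $\widehat\phi_{t,s}\le\widehat\phi_{v,u}$ whenever $[s,t]\subset[u,v]$, and $\widehat\phi_{t,s}(\alpha\varpi(\omega_{s,t}))\le\phi^{\circledast}(\alpha)\varpi(\omega_{s,t})$ for all $\alpha\ge0$, where $\phi^\circledast:\mathbb R_+\to\mathbb R_+$ is a function not depending on $(s,t)$; (c) $\|\phi_{t,s,r}\|_{\mathrm{Lip}}\le C\varpi(\omega_{r,t})$. Lipschitz perturbation. A family of continuous maps $\epsilon_{t,s}:V\to V$, $0\le s\le t\le T$, for which there is a constant $C\ge0$ with $\epsilon_{t,t}=0$, $\|\epsilon_{t,s}\|_\infty\le C\varpi(\omega_{s,t})$ and $\|\epsilon_{t,s}\|_{\mathrm{Lip}}\le C\varpi(\omega_{s,t})$ for all $0\le s\le t\le T$.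
   Formalization: The remainder is additionally required to satisfy ϖ(0)=0; this follows from its other properties when ω_{0,T}>0, and in the degenerate case ω_{0,T}=0 the claim fails without it. *)

(* Defs.v *)
From HB Require Import structures.
From mathcomp Require Import all_boot all_order all_algebra.
From mathcomp Require Import all_classical all_reals all_analysis.

Set Implicit Arguments.
Unset Strict Implicit.
Unset Printing Implicit Defensive.

Import Order.TTheory GRing.Theory Num.Theory.
Import numFieldNormedType.Exports.

Local Open Scope classical_set_scope.
Local Open Scope ring_scope.

Definition sup_norm (R : realType) (V : normedModType R) (f : V -> V) : \bar R :=
  ereal_sup [set (`|f a|)%:E | a in [set: V]].

(* When V is the zero space the supremum is over the empty set and equals -oo;
   the seminorm is only ever bounded above by nonnegative reals, so this agrees
   with the usual value 0. *)
Definition lip_norm (R : realType) (V : normedModType R) (f : V -> V) : \bar R :=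
  ereal_sup [set (`|f ab.1 - f ab.2| / `|ab.1 - ab.2|)%:E |
             ab in [set ab : V * V | ab.1 != ab.2]].

(* The numbers omega_{s,t} are [omega s t]; only 0 <= s <= t <= T matters.
   Continuity near the diagonal is required at the points (s, s), along pairs
   of the simplex; this is the weakest form of that requirement. *)
Record control (R : realType) (T : R) (omega : R -> R -> R) : Prop := Control {
  control_ge0 : forall s t : R, 0 <= s -> s <= t -> t <= T -> 0 <= omega s t;
  control_superadditive : forall r s t : R, 0 <= r -> r <= s -> s <= t -> t <= T ->
    omega r s + omega s t <= omega r t;
  control_continuous : forall s : R, 0 <= s -> s <= T ->
    (fun x : R * R => omega x.1 x.2) @
      within [set x : R * R | [/\ 0 <= x.1, x.1 <= x.2 & x.2 <= T]]
        (nbhs (s, s)) --> omega s s;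
  control_diag : forall s : R, 0 <= s -> s <= T -> omega s s = 0
}.

(* A remainder on [0, L] (L will be omega_{0,T}); values outside [0, L] are
   irrelevant. [remainder0] follows from the other fields when 0 < L; it only
   fixes the value at 0 in the degenerate case L = 0, where the condition on
   2 varpi(tau / 2) is void. *)
Record remainder (R : realType) (L : R) (varpi : R -> R) : Prop := Remainder {
  remainder_ge0 : forall x : R, 0 <= x -> x <= L -> 0 <= varpi x;
  remainder_continuous : {within `[0, L], continuous varpi};
  remainder_increasing : forall x y : R, 0 <= x -> x < y -> y <= L ->
    varpi x < varpi y;
  remainder_half : exists kappa : R, [/\ 0 < kappa, kappa < 1 &
    forall tau : R, 0 < tau -> tau <= L ->
      2 * varpi (tau / 2) <= kappa * varpi tau];
  remainder0 : varpi 0 = 0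
}.

(* Functions R_+ -> R_+ are functions R -> R constrained on [0, +oo[ only. *)
Record vanishing_modulus (R : realType) (delta : R -> R) : Prop :=
  VanishingModulus {
  modulus_ge0 : forall x : R, 0 <= x -> 0 <= delta x;
  modulus_nondecreasing : forall x y : R, 0 <= x -> x <= y -> delta x <= delta y;
  modulus_cvg0 : delta x @[x --> 0^'+] --> 0
}.

Record four_points_control (R : realType) (V : normedModType R)
    (fhat : R -> R) (fdag : R) (f : V -> V) : Prop := FourPointsControl {
  fhat_ge0 : forall x : R, 0 <= x -> 0 <= fhat x;
  fhat_nondecreasing : forall x y : R, 0 <= x -> x <= y -> fhat x <= fhat y;
  fhat_continuous : {within `[0, +oo[, continuous fhat};
  fdag_ge0 : 0 <= fdag;
  four_points_le : forall a b c d : V,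
    `|f a - f b - f c + f d| <=
      fhat (Num.max `|a - b| `|c - d|) * Num.max `|a - c| `|b - d|
      + fdag * `|a - b - c + d|
}.

(* [phihat t s] and [phiast] are the functions phihat_{t,s} and
   phi^{\circledast} of the definition of varpi-compatibility. *)
Record varpi_compatible (R : realType) (T : R) (omega : R -> R -> R)
    (varpi : R -> R) (phihat : R -> R -> R -> R) (phiast : R -> R) : Prop :=
  VarpiCompatible {
  phiast_ge0 : forall alpha : R, 0 <= alpha -> 0 <= phiast alpha;
  compatible_mono : forall u s t v : R, 0 <= u -> u <= s -> s <= t -> t <= v ->
    v <= T -> forall x : R, 0 <= x -> phihat t s x <= phihat v u x;
  compatible_scale : forall s t : R, 0 <= s -> s <= t -> t <= T ->
    forall alpha : R, 0 <= alpha ->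
      phihat t s (alpha * varpi (omega s t)) <= phiast alpha * varpi (omega s t)
}.

Definition flow_defect (R : realType) (V : normedModType R)
    (phi : R -> R -> V -> V) (t s r : R) : V -> V :=
  fun a => phi t s (phi s r a) - phi t r a.

(* phi_{t,s} is [phi t s], with the later time first. *)
Definition stable_almost_flow (R : realType) (V : normedModType R) (T : R)
    (omega : R -> R -> R) (varpi : R -> R) (phi : R -> R -> V -> V) : Prop :=
  (forall s t : R, 0 <= s -> s <= t -> t <= T -> continuous (phi t s)) /\
  exists (delta : R -> R) (M C : R) (phihat : R -> R -> R -> R)
         (phidag : R -> R -> R) (phiast : R -> R),
    [/\ vanishing_modulus delta, 0 <= M, 0 <= C,
        varpi_compatible T omega varpi phihat phiast &
        forall T' : R, 0 < T' -> T' <= T ->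
        forall r s t : R, 0 <= r -> r <= s -> s <= t -> t <= T' ->
        [/\ [/\ phi t t = id,
                (sup_norm (fun a => phi t s a - a)%R <= (delta T')%:E)%E,
                (lip_norm (phi t s) <= (1 + delta T')%R%:E)%E &
                (sup_norm (flow_defect phi t s r)
                  <= (M * varpi (omega r t))%R%:E)%E],
            four_points_control (phihat t s) (phidag t s) (phi t s) /\
              phidag t s <= 1 + delta T' &
            (lip_norm (flow_defect phi t s r)
              <= (C * varpi (omega r t))%R%:E)%E]].

Definition lipschitz_perturbation (R : realType) (V : normedModType R) (T : R)
    (omega : R -> R -> R) (varpi : R -> R) (eps : R -> R -> V -> V) : Prop :=
  (forall s t : R, 0 <= s -> s <= t -> t <= T -> continuous (eps t s)) /\
  exists2 C : R, 0 <= C &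
    forall s t : R, 0 <= s -> s <= t -> t <= T ->
    [/\ eps t t = (fun=> 0),
        (sup_norm (eps t s) <= (C * varpi (omega s t))%R%:E)%E &
        (lip_norm (eps t s) <= (C * varpi (omega s t))%R%:E)%E].

(* Main.v *)
Require Import Defs.
From mathcomp Require Import all_boot all_order all_algebra.
From mathcomp Require Import all_classical all_reals all_analysis.
From mathcomp Require Import ring lra.

(** Write [w s t] for [varpi (omega s t)], [E] for the constant of the
    perturbation, [D = 1 + delta T] and [K = E * w 0 T].  Super-additivity of
    [omega] and monotonicity of [varpi] make [w s t] increase with the interval
    [[s, t]], so every quantity of order [w s t] occurring before time [T'] is
    at most [w 0 T'], which vanishes with [T'].  This turns all perturbative
    terms into a modulus: [(1 + delta T') (1 + E w 0 T') - 1] serves as the new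
    delta.

    For a single map, [id + eps] is [(1 + k)]-Lipschitz with [k = E * w s t], and
    the second difference of [eps] on a quadrilateral is bounded by the two
    sides [a - c], [b - d] alone.  Hence [phi \o (id + eps)] keeps the same
    coefficient in front of [`|a - b - c + d|], and the loss goes into the
    function in front of [max `|a - c| `|b - d|], as a dilation and an added
    constant of order [w s t], which compatibility tolerates
    ([four_points_id_add]).

    The defect of the perturbed flow is the defect of [phi] evaluated at
    [a + eps s r a], plus two differences of one map [phi t u] along a pair of
    nearby points ([flow_defect_id_addE]).  The sup bound of these differences
    only needs [phi] to be Lipschitz.  For the Lipschitz bound one has to
    estimate how [phi (p a) - phi (q a)] varies with [a]: this is exactly what
    the 4-points control gives ([lipschitz_le_along_pair]), with a factor
    [phihat (const * w r t)], which compatibility bounds by a multiple of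
    [w r t]. *)

Import Order.TTheory GRing.Theory Num.Theory.
Import numFieldNormedType.Exports.
Local Open Scope classical_set_scope.
Local Open Scope ring_scope.

Set Implicit Arguments.
Unset Strict Implicit.
Unset Printing Implicit Defensive.

(** * Convergence inside a domain *)

Lemma cvg_within_range (T U : topologicalType) (F : set_system T) (h : T -> U)
    (A : set U) (y : U) : Filter F ->
  h x @[x --> F] --> y -> (\forall x \near F, A (h x)) ->
  h x @[x --> F] --> within A (nbhs y).
Proof.
move=> FF hy hA P /hy /= hP.
apply: filterS2 hA hP => x hx; exact.
Qed.

(** * Lipschitz maps and the 4-points control *)

Section Norms.
Context {R : realType} {V : normedModType R}.
Implicit Types (f e p q : V -> V) (a b c d : V) (k l m D K : R).

(** Stated without a quotient, so that equal points need no case distinction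
    and the zero space no special treatment, unlike for [lip_norm]. *)
Definition lipschitz_le k f := forall a b, `|f a - f b| <= k * `|a - b|.

Lemma sup_norm_leP f k : (sup_norm f <= k%:E)%E <-> forall a, `|f a| <= k.
Proof.
split=> [fk a|fk].
  by rewrite -lee_fin; apply: le_trans fk; apply: ereal_sup_ubound; exists a.
by apply: ge_ereal_sup => _ [a _ <-]; rewrite lee_fin.
Qed.

Lemma lip_norm_leP f k : (lip_norm f <= k%:E)%E <-> lipschitz_le k f.
Proof.
split=> [fk a b|fk].
  have [->|ab] := eqVneq a b; first by rewrite !subrr normr0 mulr0.
  rewrite -ler_pdivrMr ?normr_gt0 ?subr_eq0// -lee_fin.
  by apply: le_trans fk; apply: ereal_sup_ubound; exists (a, b).
apply: ge_ereal_sup => _ [[a b] /= ab <-].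
by rewrite lee_fin ler_pdivrMr ?normr_gt0 ?subr_eq0.
Qed.

Lemma lipschitz_le_weaken k l f : k <= l -> lipschitz_le k f -> lipschitz_le l f.
Proof. by move=> kl fk a b; apply: le_trans (fk a b) _; exact: ler_wpM2r. Qed.

Lemma lipschitz_le_comp k l f p : 0 <= k ->
  lipschitz_le k f -> lipschitz_le l p -> lipschitz_le (k * l) (f \o p).
Proof.
move=> k0 fk pl a b; apply: le_trans (fk _ _) _.
by rewrite -mulrA; exact: ler_wpM2l.
Qed.

Lemma addrB_ACA a b c d : (a + c) - (b + d) = (a - b) + (c - d).
Proof. by rewrite opprD addrACA. Qed.

Lemma lipschitz_le_add k l f p :
  lipschitz_le k f -> lipschitz_le l p ->
  lipschitz_le (k + l) (fun a => f a + p a).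
Proof.
move=> fk pl a b; rewrite addrB_ACA mulrDl.
by apply: le_trans (ler_normD _ _) _; rewrite lerD.
Qed.

Lemma lipschitz_le_sub k l f p :
  lipschitz_le k f -> lipschitz_le l p ->
  lipschitz_le (k + l) (fun a => f a - p a).
Proof.
move=> fk pl; apply: (lipschitz_le_add fk) => a b.
by rewrite -opprD normrN; exact: pl.
Qed.

Lemma lipschitz_le_id_add k e :
  lipschitz_le k e -> lipschitz_le (1 + k) (fun a => a + e a).
Proof. by move=> ek; apply: (lipschitz_le_add (f := id)) => // a b; rewrite mul1r. Qed.

(** The form in which the control is applied below: monotonicity of [fhat]
    allows the sides of the quadrilateral to be replaced by upper bounds. *)
Lemma four_points_le_bound (fhat : R -> R) (fdag : R) f a b c d m l k :
  four_points_control fhat fdag f ->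
  `|a - b| <= m -> `|c - d| <= m -> `|a - c| <= l -> `|b - d| <= l ->
  `|a - b - c + d| <= k ->
  `|f a - f b - f c + f d| <= fhat m * l + fdag * k.
Proof.
move=> ff ab cd ac bd abcd; apply: le_trans (four_points_le ff a b c d) _.
apply: lerD; last by apply: ler_wpM2l => //; exact: fdag_ge0 ff.
have max_ge0 (u v : V) : 0 <= Num.max `|u| `|v| by rewrite le_max normr_ge0.
apply: ler_pM => //; first exact: (fhat_ge0 ff).
  by apply: (fhat_nondecreasing ff) => //; rewrite ge_max ab.
by rewrite ge_max ac.
Qed.

Lemma second_differenceE a b c d : a - b - c + d = (a - b) - (c - d).
Proof. by rewrite opprB addrA [RHS]addrAC. Qed.

Lemma second_difference_swap a b c d : a - b - c + d = (a - c) - (b - d).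
Proof. by rewrite second_differenceE addrB_ACA [in RHS]opprD. Qed.

Lemma second_differenceD (a b c d a' b' c' d' : V) :
  (a + a') - (b + b') - (c + c') + (d + d') =
  (a - b - c + d) + (a' - b' - c' + d').
Proof.
rewrite second_differenceE (addrB_ACA a b) (addrB_ACA c d) (addrB_ACA (a - b)).
by rewrite -!second_differenceE.
Qed.

(** The quadrilateral with vertices [p a], [q a], [p b], [q b] has two short
    sides, of length at most [m], and two sides proportional to [`|a - b|]; its
    second difference is the increment of [p - q].  A Lipschitz bound on [f]
    alone would only give a constant that does not become small with [m]. *)
Lemma lipschitz_le_along_pair (fhat : R -> R) (fdag : R) f p q m l k :
  four_points_control fhat fdag f ->
  (forall a, `|p a - q a| <= m) -> lipschitz_le l p -> lipschitz_le l q ->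
  lipschitz_le k (fun a => p a - q a) ->
  lipschitz_le (fhat m * l + fdag * k) (fun a => f (p a) - f (q a)).
Proof.
move=> ff pqm pl ql pqk a b.
rewrite -second_differenceE mulrDl -!mulrA.
by apply: (four_points_le_bound ff) => //; rewrite second_differenceE.
Qed.

Lemma continuous_rescale (g : R -> R) K (r : R) : 0 <= K ->
  {within `[0, +oo[, continuous g} ->
  {within `[0, +oo[, continuous (fun x => K * g (K * x) + r)}.
Proof.
move=> K0 /subspace_continuousP gc; apply/subspace_continuousP => x x0.
have K_ge0 y : [set` `[0, +oo[%R] y -> [set` `[0, +oo[%R] (K * y).
  by rewrite /= !in_itv/= !andbT => y0; rewrite mulr_ge0.
apply: cvgD; last exact: cvg_cst.
apply: cvgM; first exact: cvg_cst.
apply: (cvg_comp _ _ _ (gc _ (K_ge0 _ x0))).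
apply: cvg_within_range; last exact: filterS K_ge0 (withinT _ _).
by apply: cvg_within_filter; apply: cvgM; [exact: cvg_cst|exact: cvg_id].
Qed.

(** The new second difference is that of [a, b, c, d] plus that of [e], and the
    latter is at most [k * (`|a - c| + `|b - d|)].  This moves [2 * k * fdag]
    into the first coefficient and leaves [fdag] itself unchanged.  With
    a bound [K] valid at all times, the dilation does not depend on the time
    interval, as the scaling condition of a compatible family requires; [D]
    replaces [fdag] because the first coefficient has to be monotone in the
    interval, and [fdag] need not be. *)
Lemma four_points_id_add (fhat : R -> R) (fdag : R) f e k K D :
  0 <= k -> k <= K -> fdag <= D -> lipschitz_le k e ->
  four_points_control fhat fdag f ->
  four_points_control
    (fun x => (1 + K) * fhat ((1 + K) * x) + 2 * k * D) fdag
    (f \o (fun a => a + e a)).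
Proof.
move=> k0 kK fD ek ff.
have K1 : 0 <= 1 + K by lra.
have D0 : 0 <= D := le_trans (fdag_ge0 ff) fD.
have c0 : 0 <= 2 * k * D by rewrite !mulr_ge0.
split.
- move=> x x0; rewrite addr_ge0// mulr_ge0//.
  by apply: (fhat_ge0 ff); rewrite mulr_ge0.
- move=> x y x0 xy; rewrite lerD2r ler_wpM2l//.
  by apply: (fhat_nondecreasing ff); [rewrite mulr_ge0|rewrite ler_wpM2l].
- exact: continuous_rescale (fhat_continuous ff).
- exact: fdag_ge0 ff.
- move=> a b c d /=.
  set m := Num.max `|a - b| _; set l := Num.max `|a - c| _.
  have [abm cdm] : `|a - b| <= m /\ `|c - d| <= m.
    by rewrite !le_max !lexx !orbT.
  have [acl bdl] : `|a - c| <= l /\ `|b - d| <= l.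
    by rewrite !le_max !lexx !orbT.
  have id_e z x y : `|x - y| <= z -> `|(x + e x) - (y + e y)| <= (1 + K) * z.
    move=> xyz; apply: le_trans (lipschitz_le_id_add ek x y) _.
    by apply: ler_pM => //; lra.
  have e4 : `|e a - e b - e c + e d| <= 2 * k * l.
    rewrite second_difference_swap; apply: le_trans (ler_normB _ _) _.
    have := ler_wpM2l k0 acl; have := ler_wpM2l k0 bdl.
    by move: (ek a c) (ek b d); lra.
  have q4 : `|(a + e a) - (b + e b) - (c + e c) + (d + e d)| <=
      `|a - b - c + d| + 2 * k * l.
    by rewrite second_differenceD; apply: le_trans (ler_normD _ _) _; rewrite lerD2l.
  apply: le_trans (four_points_le_bound ff (id_e _ _ _ abm) (id_e _ _ _ cdm)
    (id_e _ _ _ acl) (id_e _ _ _ bdl) q4) _.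
  have l0 : 0 <= l by apply: le_trans acl.
  have : fdag * (2 * k * l) <= D * (2 * k * l) by rewrite ler_wpM2r// !mulr_ge0.
  by nra.
Qed.

End Norms.

(** * Remainders of a control *)

Section ControlledRemainder.
Context {R : realType} {T : R} {omega : R -> R -> R} {varpi : R -> R}.
Context (omega_control : control T omega)
  (varpi_remainder : remainder (omega 0 T) varpi).

Lemma control_le u s t v : 0 <= u -> u <= s -> s <= t -> t <= v -> v <= T ->
  omega s t <= omega u v.
Proof.
move=> u0 us st tv vT.
have sT : s <= T by lra.
have := control_superadditive omega_control u0 us (le_trans st tv) vT.
have := control_superadditive omega_control (le_trans u0 us) st tv vT.
have := control_ge0 omega_control u0 us sT.
have := control_ge0 omega_control (le_trans (le_trans u0 us) st) tv vT.
lra.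
Qed.

Lemma remainder_control_ge0 s t : 0 <= s -> s <= t -> t <= T ->
  0 <= varpi (omega s t).
Proof.
move=> s0 st tT; apply: (remainder_ge0 varpi_remainder).
  exact: (control_ge0 omega_control).
exact: control_le.
Qed.

Lemma remainder_control_le u s t v :
  0 <= u -> u <= s -> s <= t -> t <= v -> v <= T ->
  varpi (omega s t) <= varpi (omega u v).
Proof.
move=> u0 us st tv vT; have := control_le u0 us st tv vT.
rewrite le_eqVlt => /predU1P[->//|lt_w]; apply: ltW.
apply: (remainder_increasing varpi_remainder) => //.
  by apply: (control_ge0 omega_control) => //; lra.
by apply: control_le => //; lra.
Qed.

(** Truncating at [T] extends the map to all of [R_+], where a modulus has to
    be defined.  It tends to 0 by continuity of [omega] at [(0, 0)] followed by
    continuity of [varpi] at 0; both are relative to a domain, which the curves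
    [x |-> (0, min x T)] and [x |-> omega 0 (min x T)] do not leave. *)
Lemma vanishing_remainder_control : 0 < T ->
  vanishing_modulus (fun x => varpi (omega 0 (Num.min x T))).
Proof.
move=> T0.
have min_ge0 x : 0 <= x -> 0 <= Num.min x T.
  by move=> x0; rewrite le_min x0 ltW.
have min_leT x : Num.min x T <= T by rewrite ge_min lexx orbT.
split.
- by move=> x x0; apply: remainder_control_ge0; rewrite ?min_ge0.
- move=> x y x0 xy; apply: remainder_control_le; rewrite ?min_ge0//.
  by rewrite le_min min_leT andbT ge_min xy.
have min0 : Num.min x T @[x --> 0^'+] --> (0 : R).
  have id0 : x @[x --> 0^'+] --> (0 : R).
    by apply: cvg_at_right_filter; exact: cvg_id.
  apply: cvg_trans id0.
  apply: near_eq_cvg; near=> x; apply/esym/min_idPl.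
  by near: x; exact: nbhs_right_le.
have omega0 : omega 0 (Num.min x T) @[x --> 0^'+] --> (0 : R).
  have oc := control_continuous omega_control (lexx 0) (ltW T0).
  rewrite (control_diag omega_control (lexx 0) (ltW T0)) in oc.
  apply: (cvg_comp (fun x => (0, Num.min x T)) _ _ oc).
  apply: (@cvg_within_range _ _ _ (fun x => (0, Num.min x T))).
    exact: cvg_pair (cvg_cst _) min0.
  near=> x; rewrite /=; split => //.
  by apply: min_ge0; near: x; exact: nbhs_right_ge.
have L0 : 0 <= omega 0 T by apply: (control_ge0 omega_control) => //; exact: ltW.
have /subspace_continuousP vc := remainder_continuous varpi_remainder.
have vc0 : varpi x @[x --> within `[0, omega 0 T] (nbhs 0)] --> varpi 0.
  by apply: vc; rewrite /= in_itv/= lexx.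
rewrite (remainder0 varpi_remainder) in vc0.
apply: (cvg_comp (fun x => omega 0 (Num.min x T)) _ _ vc0).
apply: cvg_within_range => //.
near=> x; rewrite /= in_itv/=.
have x0 : 0 <= x by near: x; exact: nbhs_right_ge.
rewrite (control_ge0 omega_control) ?control_le ?min_ge0//.
Unshelve. all: by end_near.
Qed.

End ControlledRemainder.

(** The function is [(1 + delta x) * (1 + k * w x) - 1]: the excess over 1 of
    the Lipschitz constant of a composition. *)
Lemma vanishing_modulus_combine {R : realType} (delta w : R -> R) (k : R) :
  0 <= k -> vanishing_modulus delta -> vanishing_modulus w ->
  vanishing_modulus (fun x => delta x + k * w x + delta x * (k * w x)).
Proof.
move=> k0 hd hw.
have kw0 x : 0 <= x -> 0 <= k * w x.
  by move=> x0; rewrite mulr_ge0// (modulus_ge0 hw).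
split.
- move=> x x0; have d0 := modulus_ge0 hd x0; have kwx0 := kw0 x x0.
  by rewrite !addr_ge0// mulr_ge0.
- move=> x y x0 xy.
  have dxy := modulus_nondecreasing hd x0 xy.
  have wxy := ler_wpM2l k0 (modulus_nondecreasing hw x0 xy).
  by rewrite !lerD// ler_pM ?kw0// (modulus_ge0 hd).
have hd0 := modulus_cvg0 hd.
have hw0 : k * w x @[x --> 0^'+] --> k * 0.
  by apply: cvgM (modulus_cvg0 hw); exact: cvg_cst.
by have := cvgD (cvgD hd0 hw0) (cvgM hd0 hw0); rewrite !mulr0 !addr0; apply.
Qed.

(** * The defect of the perturbed flow *)

Section PerturbedDefect.
Context {R : realType} {V : normedModType R} {phi eps : R -> R -> V -> V}.
Context {r s t : R}.

Let psi t s := phi t s \o (fun a => a + eps t s a).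

(** The point is to perturb one argument at a time: first drop [eps t s], then
    use the defect of [phi] from the common starting point [g], then replace
    [eps s r] by [eps t r]. *)
Lemma flow_defect_id_addE (a : V) :
  let g := a + eps s r a in let x := phi s r g in
  flow_defect psi t s r a =
  (phi t s (x + eps t s x) - phi t s x) + flow_defect phi t s r g
  + (phi t r g - phi t r (a + eps t r a)).
Proof. by move=> g x; rewrite /flow_defect/= [LHS]/= -/g -/x !addrA !subrK. Qed.

Lemma flow_defect_id_add_bounded (D k m : R) :
  0 <= D -> lipschitz_le D (phi t s) -> lipschitz_le D (phi t r) ->
  (forall a, `|flow_defect phi t s r a| <= m) ->
  (forall a, `|eps t s a| <= k) -> (forall a, `|eps s r a| <= k) ->
  (forall a, `|eps t r a| <= k) ->
  forall a, `|flow_defect psi t s r a| <= m + 3 * D * k.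
Proof.
move=> D0 lip_ts lip_tr dm ets esr etr a; rewrite flow_defect_id_addE.
set g := a + _; set x := phi s r g.
apply: le_trans (ler_normD _ _) _; apply: le_trans (lerD (ler_normD _ _) (lexx _)) _.
have h1 : `|phi t s (x + eps t s x) - phi t s x| <= D * k.
  by apply: le_trans (lip_ts _ _) _; rewrite addrAC subrr add0r ler_wpM2l.
have h2 : `|phi t r g - phi t r (a + eps t r a)| <= D * (2 * k).
  apply: le_trans (lip_tr _ _) _; rewrite addrB_ACA subrr add0r ler_wpM2l//.
  by apply: le_trans (ler_normB _ _) _; move: (esr a) (etr a); lra.
by move: (dm g) h1 h2; lra.
Qed.

(** The first and third terms of [flow_defect_id_addE] compare [phi] along two
    nearby maps, at distance [k] and [2 * k] respectively, whose difference is
    Lipschitz with the same constants; the first is moreover precomposed with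
    the perturbed flow from [r] to [s], which costs the factor [D * (1 + K)]. *)
Lemma flow_defect_id_add_lipschitz (hat_ts hat_tr : R -> R) (dag_ts dag_tr : R)
    (D K k c h1 h2 : R) :
  0 <= D -> 0 <= k -> k <= K -> 0 <= c ->
  four_points_control hat_ts dag_ts (phi t s) -> dag_ts <= D ->
  four_points_control hat_tr dag_tr (phi t r) -> dag_tr <= D ->
  lipschitz_le D (phi s r) -> lipschitz_le c (flow_defect phi t s r) ->
  (forall a, `|eps t s a| <= k) -> (forall a, `|eps s r a| <= k) ->
  (forall a, `|eps t r a| <= k) ->
  lipschitz_le k (eps t s) -> lipschitz_le k (eps s r) ->
  lipschitz_le k (eps t r) ->
  hat_ts k <= h1 -> hat_tr (2 * k) <= h2 ->
  lipschitz_le ((h1 * (1 + K) + D * k) * (D * (1 + K)) + c * (1 + K)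
    + (h2 * (1 + K) + D * (2 * k))) (flow_defect psi t s r).
Proof.
move=> D0 k0 kK c0 fts dts ftr dtr lsr ldef bts bsr btr lts lsr' ltr hh1 hh2.
have lip_id u v : lipschitz_le k (eps u v) ->
    lipschitz_le (1 + K) (fun a => a + eps u v a).
  by move=> /lipschitz_le_id_add; apply: lipschitz_le_weaken; rewrite lerD2l.
have h10 : 0 <= h1 by apply: le_trans hh1; exact: (fhat_ge0 fts).
have K1 : 0 <= 1 + K by lra.
have along_ts : lipschitz_le (h1 * (1 + K) + D * k)
    (fun x => phi t s (x + eps t s x) - phi t s x).
  apply: (@lipschitz_le_weaken _ _ (hat_ts k * (1 + K) + dag_ts * k)).
    by rewrite lerD// ler_wpM2r.
  apply: (lipschitz_le_along_pair (q := id) fts) => //.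
  - by move=> x; rewrite addrAC subrr add0r.
  - exact: lip_id.
  - by move=> a b; rewrite ler_peMl//; lra.
  - by move=> a b /=; rewrite (addrAC a) (addrAC b) !subrr !add0r.
have along_tr : lipschitz_le (h2 * (1 + K) + D * (2 * k))
    (fun a => phi t r (a + eps s r a) - phi t r (a + eps t r a)).
  apply: (@lipschitz_le_weaken _ _ (hat_tr (2 * k) * (1 + K) + dag_tr * (2 * k))).
    by rewrite lerD// ler_wpM2r// mulr_ge0.
  apply: (lipschitz_le_along_pair ftr) => //.
  - move=> a; rewrite addrB_ACA subrr add0r; apply: le_trans (ler_normB _ _) _.
    by move: (bsr a) (btr a); lra.
  - exact: lip_id.
  - exact: lip_id.
  - have -> : 2 * k = k + k by lra.
    move=> a b; rewrite (addrB_ACA a a) (addrB_ACA b b) !subrr !add0r.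
    exact: (lipschitz_le_sub lsr' ltr).
have lip_psi : lipschitz_le (D * (1 + K)) (psi s r).
  by apply: lipschitz_le_comp => //; exact: lip_id.
have -> : flow_defect psi t s r =
  fun a => ((fun x => phi t s (x + eps t s x) - phi t s x) \o psi s r) a
    + (flow_defect phi t s r \o (fun a => a + eps s r a)) a
    + (phi t r (a + eps s r a) - phi t r (a + eps t r a)).
  by apply/funext => a; rewrite flow_defect_id_addE.
apply: lipschitz_le_add along_tr; apply: lipschitz_le_add.
  by apply: lipschitz_le_comp => //; rewrite addr_ge0// mulr_ge0.
by apply: lipschitz_le_comp => //; exact: lip_id.
Qed.

End PerturbedDefect.

(** * Stability under perturbation *)

Theorem proposition9 (R : realType) (V : completeNormedModType R) (T : R)
    (omega : R -> R -> R) (varpi : R -> R) (phi eps : R -> R -> V -> V)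
    (T_gt0 : 0 < T)
    (omega_control : control T omega)
    (varpi_remainder : remainder (omega 0 T) varpi)
    (phi_flow : stable_almost_flow T omega varpi phi)
    (eps_perturbation : lipschitz_perturbation T omega varpi eps) :
  stable_almost_flow T omega varpi
    (fun t s : R => phi t s \o (fun a : V => a + eps t s a)).
Proof.
case: phi_flow => phi_cont [delta [M [C [phihat [phidag [phiast]]]]]].
case=> delta_mod M0 C0 compat phiP.
case: eps_perturbation => eps_cont [E E0 epsP].
split=> [s t s0 st tT a|].
  apply: (@continuous_comp _ _ _ (fun a => a + eps t s a) (phi t s)).
    by apply: cvgD; [exact: cvg_id|exact: (eps_cont s t s0 st tT)].
  exact: (phi_cont s t s0 st tT).
pose w s t := varpi (omega s t).
pose K := E * w 0 T.
pose D := 1 + delta T.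
have w_ge0 s t : 0 <= s -> s <= t -> t <= T -> 0 <= w s t.
  exact: (remainder_control_ge0 omega_control varpi_remainder).
have w_le u s t v : 0 <= u -> u <= s -> s <= t -> t <= v -> v <= T ->
  w s t <= w u v
  by exact: (remainder_control_le omega_control varpi_remainder).
have K1 : 0 <= 1 + K by rewrite addr_ge0// mulr_ge0// w_ge0// ltW.
have deltaT : 0 <= delta T by apply: (modulus_ge0 delta_mod); exact: ltW.
have D0 : 0 <= D by rewrite addr_ge0.
have KE s t : 0 <= s -> s <= t -> t <= T -> 0 <= E * w s t <= K.
  move=> s0 st tT; rewrite mulr_ge0 ?w_ge0//=.
  by apply: ler_wpM2l => //; exact: w_le.
have eps_sup s t : 0 <= s -> s <= t -> t <= T ->
    forall a, `|eps t s a| <= E * w s t.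
  by move=> s0 st tT; apply/sup_norm_leP; have [] := epsP s t s0 st tT.
have eps_lip s t : 0 <= s -> s <= t -> t <= T ->
    lipschitz_le (E * w s t) (eps t s).
  by move=> s0 st tT; apply/lip_norm_leP; have [] := epsP s t s0 st tT.
exists (fun x => delta x + E * w 0 (Num.min x T)
    + delta x * (E * w 0 (Num.min x T))).
exists (M + 3 * D * E).
exists ((phiast E * (1 + K) + D * E) * (D * (1 + K)) + C * (1 + K)
    + (phiast (2 * E) * (1 + K) + D * (2 * E))).
exists (fun t s x => (1 + K) * phihat t s ((1 + K) * x) + 2 * (E * w s t) * D).
exists phidag, (fun alpha => (1 + K) * phiast ((1 + K) * alpha) + 2 * E * D).
have ast0 := phiast_ge0 compat.
split.
- apply: vanishing_modulus_combine => //.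
  exact: (vanishing_remainder_control omega_control varpi_remainder).
- by rewrite addr_ge0// !mulr_ge0.
- by repeat first [done|apply: addr_ge0|apply: mulr_ge0|apply: ast0].
- split.
  + by move=> al al0; rewrite addr_ge0// !mulr_ge0 ?ast0// mulr_ge0.
  + move=> u s t v u0 us st tv vT x x0; rewrite lerD//.
      by rewrite ler_wpM2l// (compatible_mono compat)// mulr_ge0.
    by rewrite ler_wpM2r// ler_wpM2l// ler_wpM2l// w_le.
  + move=> s t s0 st tT al al0; rewrite mulrDl mulrA -/(w s t).
    have := compatible_scale compat s0 st tT (mulr_ge0 K1 al0).
    by move=> /(ler_wpM2l K1); rewrite -/(w s t); lra.
move=> T' T'0 T'T r s t r0 rs st tT'.
have s0 := le_trans r0 rs; have t0 := le_trans s0 st.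
have rt := le_trans rs st; have tT := le_trans tT' T'T.
have sT := le_trans st tT.
have delta0 : 0 <= delta T' by apply: (modulus_ge0 delta_mod); exact: ltW.
have -> : Num.min T' T = T' by apply/min_idPl.
have wT' : E * w s t <= E * w 0 T' by rewrite ler_wpM2l// w_le.
have [wst0 wstK] := andP (KE s t s0 st tT).
have [wrt0 wrtK] := andP (KE r t r0 rt tT).
have w_st_rt : E * w s t <= E * w r t by rewrite ler_wpM2l// w_le.
have w_rs_rt : E * w r s <= E * w r t by rewrite ler_wpM2l// w_le.
have [[phi_tt /sup_norm_leP phi_id /lip_norm_leP phi_lip /sup_norm_leP phi_def]
  [phi4 dag_le] /lip_norm_leP phi_deflip] := phiP T' T'0 T'T r s t r0 rs st tT'.
(* The constants must not depend on the horizon: use the bounds at [T]. *)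
have phiD u v : 0 <= u -> u <= v -> v <= T ->
    [/\ lipschitz_le D (phi v u),
      four_points_control (phihat v u) (phidag v u) (phi v u) &
      phidag v u <= D].
  move=> u0 uv vT.
  by have [[_ _ /lip_norm_leP ? _] [? ?] _] :=
    phiP T T_gt0 (lexx T) u u v u0 (lexx u) uv vT.
have [lip_ts four_ts dag_ts] := phiD s t s0 st tT.
have [lip_rs _ _] := phiD r s r0 rs sT.
have [lip_rt four_rt dag_rt] := phiD r t r0 rt tT.
have b_ts a : `|eps t s a| <= E * w r t.
  exact: le_trans (eps_sup s t s0 st tT a) w_st_rt.
have b_sr a : `|eps s r a| <= E * w r t.
  exact: le_trans (eps_sup r s r0 rs sT a) w_rs_rt.
split; [split|split|].
- have [-> _ _] := epsP t t t0 (lexx t) tT.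
  by rewrite phi_tt; apply/funext => a /=; rewrite addr0.
- apply/sup_norm_leP => a /=.
  have -> : phi t s (a + eps t s a) - a =
      (phi t s (a + eps t s a) - (a + eps t s a)) + eps t s a.
    by rewrite opprD addrA subrK.
  apply: le_trans (ler_normD _ _) _.
  have := eps_sup s t s0 st tT a; have := phi_id (a + eps t s a).
  have : 0 <= delta T' * (E * w 0 T') by rewrite mulr_ge0// (le_trans wst0).
  by lra.
- apply/lip_norm_leP.
  apply: (@lipschitz_le_weaken _ _ ((1 + delta T') * (1 + E * w s t))).
    have := ler_wpM2l delta0 wT'; lra.
  apply: lipschitz_le_comp => //; first by rewrite addr_ge0.
  exact/lipschitz_le_id_add/eps_lip.
- apply/sup_norm_leP => a; rewrite mulrDl -[_ * E * _]mulrA.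
  by apply: flow_defect_id_add_bounded => //; exact: eps_sup.
- exact: (four_points_id_add wst0 wstK dag_ts (eps_lip s t s0 st tT) phi4).
- have wT'0 := le_trans wst0 wT'; have := mulr_ge0 delta0 wT'0.
  by lra.
- apply/lip_norm_leP.
  have := @flow_defect_id_add_lipschitz _ _ phi eps r s t _ _ _ _ D K
    (E * w r t) (C * w r t) (phiast E * w r t) (phiast (2 * E) * w r t)
    D0 wrt0 wrtK _ four_ts dag_ts four_rt dag_rt lip_rs phi_deflip
    b_ts b_sr (eps_sup r t r0 rt tT)
    (lipschitz_le_weaken w_st_rt (eps_lip s t s0 st tT))
    (lipschitz_le_weaken w_rs_rt (eps_lip r s r0 rs sT))
    (eps_lip r t r0 rt tT).
  rewrite mulrA -/(w r t) => lip.
  apply: lipschitz_le_weaken (lip _ _ _).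
  + by rewrite le_eqVlt; apply/predU1P; left; ring.
  + by rewrite mulr_ge0// w_ge0.
  (* The displacement is measured by [w r t], not [w s t], so [phihat t s] is
     compared with [phihat t r] before scaling. *)
  + apply: le_trans (compatible_mono compat r0 rs st (lexx t) tT wrt0) _.
    exact: (compatible_scale compat r0 rt tT E0).
  + exact: (compatible_scale compat r0 rt tT (mulr_ge0 (ler0n R 2) E0)).
Qed.
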